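(* Let $V_1,V_2,V_3$ be finite-dimensional complex vector spaces with $\dim V_1=v_1$, let $S \in V_1\otimes V_2 \otimes V_3$, and let $p\ge 1$ be an integer. Fix a basis $e_1, \ldots ,e_{v_1}$ of $V_1$, write $$S = \sum_{i = 1}^{v_1} e_i \otimes M_i$$ with matrices $M_i \in V_2 \otimes V_3$, and assume $M_1 \neq 0$. For complex numbers $\lambda_2, \dots , \lambda_{v_1}$ define $$\hat{S}(\lambda_2, \dots , \lambda_{v_1}) = \sum_{j = 2}^{v_1} e_j \otimes (M_j - \lambda_j M_1).$$ Then: (i) There exist $\lambda_2, \dots , \lambda_{v_1}\in \mathbb{C}$ such that $R^{\blacksquare p}(\hat{S}(\lambda_2, \dots , \lambda_{v_1})) \leq R^{\blacksquare p}(S) - 1$. (ii) Assume that $M_1$ has rank at most $p$. Then, for all $\lambda_2, \dots , \lambda_{v_1}\in\mathbb{C}$, $R^{\blacksquare p}(\hat{S}(\lambda_2, \dots , \lambda_{v_1})) \geq R^{\blacksquare p}(S) - 1$. Hence, if $M_1$ has rank at most $p$, there always exist $\lambda_2, \dots , \lambda_{v_1}\in\mathbb{C}$ such that $R^{\blacksquare p}(\hat{S}(\lambda_2, \dots , \lambda_{v_1})) = R^{\blacksquare p}(S) - 1$.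
   Context: A tensor $T \in U_1 \otimes U_2 \otimes U_3$ restricts to $S \in V_1\otimes V_2\otimes V_3$, written $T\ge S$, if there are linear maps $A_i: U_i\to V_i$ ($i=1,2,3$) with $S=(A_1\otimes A_2\otimes A_3)T$. The unit tensor is $\langle r \rangle = \sum_{i=1}^r e_i\otimes e_i\otimes e_i\in\mathbb{C}^r\otimes\mathbb{C}^r\otimes\mathbb{C}^r$ (with $\langle 0\rangle=0$). For $p\ge 1$, $T^{\blacksquare p} = T\boxtimes\langle 1,1,p\rangle\in U_1\otimes(U_2\otimes\mathbb{C}^p)\otimes(U_3\otimes\mathbb{C}^p)$, where $\boxtimes$ is the Kronecker product and $\langle 1,1,p\rangle = e_1\otimes\sum_{l=1}^p e_l\otimes e_l \in \mathbb{C}^1\otimes\mathbb{C}^p\otimes\mathbb{C}^p$. Explicitly, if $T=\sum T_{ijk}\,e_i\otimes e_j\otimes e_k$ in bases, then $T^{\blacksquare p}=\sum_{i,j,k}\sum_{l=1}^p T_{ijk}\, e_i\otimes(e_j\otimes e_l)\otimes(e_k\otimes e_l)$. The $p$-th aided rank of a tensor $S$ is $R^{\blacksquare p}(S)=\min\{r\ge 0:\langle r\rangle^{\blacksquare p}\ge S\}$. Elements of $V_2\otimes V_3$ are regarded as matrices (with the usual rank). *)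

(* Defs.v *)
From HB Require Import structures.
From mathcomp Require Import all_boot all_order all_algebra.
From mathcomp Require Import complex.
From mathcomp Require Import boolp classical_sets reals.

Set Implicit Arguments.
Unset Strict Implicit.
Unset Printing Implicit Defensive.

Import GRing.Theory.
Local Open Scope ring_scope.

Section Tensors.
Variable K : fieldType.
Implicit Types U V W : vectType K.

(* For finite-dimensional U and V, the tensor product of U and V is the space
   of linear maps from the dual of U to V; u (x) v is phi |-> phi(u) v. *)
Definition dual U : vectType K := 'Hom(U, K^o).
Definition tensor U V : vectType K := 'Hom(dual U, V).

Definition tens_fun U V (u : U) (v : V) (phi : dual U) : V := phi u *: v.

Fact tens_fun_is_linear U V (u : U) (v : V) : linear (tens_fun u v).
Proof.
by move=> a phi psi; rewrite /tens_fun add_lfunE scale_lfunE scalerDl scalerA.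
Qed.

HB.instance Definition _ U V (u : U) (v : V) :=
  GRing.isLinear.Build K (dual U) V _ (tens_fun u v) (tens_fun_is_linear u v).

Definition tens U V (u : U) (v : V) : tensor U V := linfun (tens_fun u v).

Lemma tensE U V (u : U) (v : V) (phi : dual U) : tens u v phi = phi u *: v.
Proof. by rewrite lfunE. Qed.

Fact tens_is_linear U V (u : U) : linear (@tens U V u).
Proof.
move=> a v w; apply/lfunP => phi.
by rewrite add_lfunE scale_lfunE !tensE scalerDr !scalerA mulrC.
Qed.

HB.instance Definition _ U V (u : U) :=
  GRing.isLinear.Build K V (tensor U V) _ (@tens U V u) (@tens_is_linear U V u).

Definition tensr U V (v : V) (u : U) : tensor U V := tens u v.

Fact tensr_is_linear U V (v : V) : linear (@tensr U V v).
Proof.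
move=> a u w; apply/lfunP => phi.
by rewrite add_lfunE scale_lfunE !tensE linearP scalerDl scalerA.
Qed.

HB.instance Definition _ U V (v : V) :=
  GRing.isLinear.Build K U (tensor U V) _ (@tensr U V v)
    (@tensr_is_linear U V v).

Lemma tens_decomp U V n (e : n.-tuple U) (t : tensor U V) :
  basis_of fullv e -> 
  t = \sum_(i < n) tens e`_i (t (@linfun K U K^o (coord e i))).
Proof.
move=> eb; apply/lfunP => phi; rewrite sum_lfunE.
have {1}-> : phi = \sum_(i < n) (phi e`_i : K) *: (@linfun K U K^o (coord e i) : dual U).
  apply/lfunP => u; rewrite {1}(coord_basis eb (memvf u)) linear_sum sum_lfunE.
  apply: eq_bigr => i _.
  by rewrite linearZ scale_lfunE lfunE; exact: mulrC.
by rewrite linear_sum; apply: eq_bigr => i _; rewrite tensE linearZ.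
Qed.

Definition dual_map U U' (A : 'Hom(U, U')) (phi : dual U') : dual U :=
  (phi \o A)%VF.

Fact dual_map_is_linear U U' (A : 'Hom(U, U')) : linear (dual_map A).
Proof.
move=> a phi psi; apply/lfunP => u.
by rewrite /dual_map !(add_lfunE, scale_lfunE, comp_lfunE).
Qed.

HB.instance Definition _ U U' (A : 'Hom(U, U')) :=
  GRing.isLinear.Build K (dual U') (dual U) _ (dual_map A)
    (dual_map_is_linear A).

(* A (x) B, characterized on pure tensors by tens_map_tens below *)
Definition tens_map U U' V V' (A : 'Hom(U, U')) (B : 'Hom(V, V'))
  (t : tensor U V) : tensor U' V' := (B \o t \o linfun (dual_map A))%VF.

Lemma tens_mapE U U' V V' (A : 'Hom(U, U')) (B : 'Hom(V, V'))
  (t : tensor U V) phi : tens_map A B t phi = B (t (phi \o A)%VF).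
Proof. by rewrite !comp_lfunE lfunE. Qed.

Fact tens_map_is_linear U U' V V' (A : 'Hom(U, U')) (B : 'Hom(V, V')) :
  linear (tens_map A B).
Proof.
move=> a s t; apply/lfunP => phi.
by rewrite !(add_lfunE, scale_lfunE, tens_mapE) linearP.
Qed.

HB.instance Definition _ U U' V V' (A : 'Hom(U, U')) (B : 'Hom(V, V')) :=
  GRing.isLinear.Build K (tensor U V) (tensor U' V') _ (tens_map A B)
    (tens_map_is_linear A B).

Lemma tens_map_tens U U' V V' (A : 'Hom(U, U')) (B : 'Hom(V, V')) u v :
  tens_map A B (tens u v) = tens (A u) (B v).
Proof.
by apply/lfunP => phi; rewrite tens_mapE !tensE comp_lfunE linearZ.
Qed.

Definition tensor3 U V W : vectType K := tensor U (tensor V W).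

Definition tens3 U V W (u : U) (v : V) (w : W) : tensor3 U V W :=
  tens u (tens v w).

Definition tens_map3 U U' V V' W W' (A : 'Hom(U, U')) (B : 'Hom(V, V'))
  (C : 'Hom(W, W')) : tensor3 U V W -> tensor3 U' V' W' :=
  tens_map A (linfun (tens_map B C)).

Lemma tens_map3_tens3 U U' V V' W W' (A : 'Hom(U, U')) (B : 'Hom(V, V'))
  (C : 'Hom(W, W')) u v w :
  tens_map3 A B C (tens3 u v w) = tens3 (A u) (B v) (C w).
Proof. by rewrite /tens_map3 tens_map_tens lfunE /= tens_map_tens. Qed.

(* T >= S *)
Definition restricts U1 U2 U3 V1 V2 V3
  (T : tensor3 U1 U2 U3) (S : tensor3 V1 V2 V3) : Prop :=
  exists (A1 : 'Hom(U1, V1)) (A2 : 'Hom(U2, V2)) (A3 : 'Hom(U3, V3)),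
    S = tens_map3 A1 A2 A3 T.

Definition std_vec n (i : 'I_n) : 'rV[K]_n := delta_mx 0 i.

Definition unit_tensor r : tensor3 'rV[K]_r 'rV[K]_r 'rV[K]_r :=
  \sum_(i < r) tens3 (std_vec i) (std_vec i) (std_vec i).

(* T boxtimes <1,1,p>, the factor C^1 being dropped: the linear extension of
   u (x) v (x) w |-> \sum_l u (x) (v (x) e_l) (x) (w (x) e_l). *)
Definition aided p U V W (T : tensor3 U V W) :
    tensor3 U (tensor V 'rV[K]_p) (tensor W 'rV[K]_p) :=
  \sum_(l < p) tens_map3 \1%VF
    (linfun (tensr (std_vec l))) (linfun (tensr (std_vec l))) T.

Lemma aided_is_linear p U V W : linear (@aided p U V W).
Proof.
move=> a S T; rewrite /aided scaler_sumr -big_split.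
by apply: eq_bigr => l _; rewrite /tens_map3 linearP.
Qed.

Lemma aided_tens3 p U V W (u : U) (v : V) (w : W) :
  aided p (tens3 u v w) =
  \sum_(l < p) tens3 u (tens v (std_vec l)) (tens w (std_vec l)).
Proof.
by apply: eq_bigr => l _; rewrite tens_map3_tens3 id_lfunE !lfunE.
Qed.

Definition aided_le p U V W (S : tensor3 U V W) (r : nat) : Prop :=
  restricts (aided p (unit_tensor r)) S.

(* The minimum of {r | <r>^{aided p} >= S}; it exists for 0 < p, see aided_rankP. *)
Definition aided_rank p U V W (S : tensor3 U V W) : nat :=
  xget 0%N [set r | aided_le p S r /\ forall s, aided_le p S s -> (r <= s)%N].

(* M : tensor V W is a linear map from the dual of V to W; in bases its matrix
   is the array of coefficients of M. *)
Definition mat_rank V W (M : tensor V W) : nat := \dim (limg M).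

(* \hat S(lambda): the basis vectors e_1, ..., e_{v_1} are indexed from 0, and
   lambda j is the coefficient attached to e_{lift ord0 j}. *)
Definition slice_red V1 V2 V3 n (e : n.+1.-tuple V1)
    (M : 'I_n.+1 -> tensor V2 V3) (lambda : 'I_n -> K) : tensor3 V1 V2 V3 :=
  \sum_(j < n)
    tens e`_(lift ord0 j) (M (lift ord0 j) - lambda j *: M ord0).

Lemma aided_unit p r : aided p (unit_tensor r) =
  \sum_(i < r) \sum_(l < p) tens3 (std_vec i)
    (tens (std_vec i) (std_vec l)) (tens (std_vec i) (std_vec l)).
Proof.
rewrite /unit_tensor.
pose f := GRing.isLinear.Build K _ _ _ _
  (@aided_is_linear p 'rV[K]_r 'rV[K]_r 'rV[K]_r).
pose F : {linear _ -> _} := HB.pack (@aided p 'rV[K]_r 'rV[K]_r 'rV[K]_r) f.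
rewrite -[LHS]/(F _) linear_sum /=; apply: eq_bigr => i _.
exact: aided_tens3.
Qed.

Lemma aided_le_sum p r U V W (u : 'I_r -> U) (v : 'I_r -> V) (w : 'I_r -> W) :
  (0 < p)%N -> aided_le p (\sum_(i < r) tens3 (u i) (v i) (w i)) r.
Proof.
case: p => // p _.
pose lc n (X : vectType K) (x : 'I_n -> X) (a : 'rV[K]_n) :=
  \sum_(i < n) a 0 i *: x i.
have lcl n (X : vectType K) (x : 'I_n -> X) : linear (lc n X x).
  move=> a b c; rewrite /lc scaler_sumr -big_split; apply: eq_bigr => i _.
  by rewrite !mxE scalerDl scalerA.
pose LC n (X : vectType K) (x : 'I_n -> X) : {linear 'rV[K]_n -> X} :=
  HB.pack (lc n X x) (GRing.isLinear.Build K _ _ _ _ (lcl n X x)).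
have LCE n (X : vectType K) (x : 'I_n -> X) i : LC n X x (std_vec i) = x i.
  rewrite /= /lc (bigD1 i) //= big1 ?addr0 => [|j ji].
    by rewrite mxE !eqxx scale1r.
  by rewrite mxE (negPf ji) andbF scale0r.
pose ev (i : 'I_r) : {linear 'rV[K]_r -> K^o} :=
  LC r K^o (fun j => (i == j)%:R).
pose h (X : vectType K) (x : 'I_r -> X) (t : tensor 'rV[K]_r 'rV[K]_p.+1) :=
  \sum_(i < r) (t (linfun (ev i))) 0 ord0 *: x i.
have hl (X : vectType K) (x : 'I_r -> X) : linear (h X x).
  move=> a s t; rewrite /h scaler_sumr -big_split; apply: eq_bigr => i _.
  by rewrite add_lfunE scale_lfunE !mxE scalerDl scalerA.
pose H (X : vectType K) (x : 'I_r -> X) : {linear tensor _ _ -> X} :=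
  HB.pack (h X x) (GRing.isLinear.Build K _ _ _ _ (hl X x)).
have HE (X : vectType K) (x : 'I_r -> X) i l :
    H X x (tens (std_vec i) (std_vec l)) = (l == ord0)%:R *: x i.
  rewrite -[LHS]/(h X x _) /h (bigD1 i) // big1 ?addr0 => [|j ji].
    rewrite tensE (lfunE (ev i)) LCE eqxx scale1r mxE eqxx eq_sym. exact: addr0.
  by rewrite tensE (lfunE (ev j)) LCE (negPf ji) scale0r mxE scale0r.
exists (linfun (LC r U u)), (linfun (H V v)), (linfun (H W w)).
rewrite aided_unit /tens_map3 linear_sum; apply: eq_bigr => i _.
rewrite linear_sum (bigD1 ord0) //= big1 ?addr0 => [|l l0].
  rewrite -/(tens_map3 _ _ _ _) tens_map3_tens3.
  by rewrite (lfunE (LC _ _ _)) (lfunE (H V v)) (lfunE (H W w)) LCE !HE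
    !scale1r.
rewrite -/(tens_map3 _ _ _ _) tens_map3_tens3.
by rewrite (lfunE (H V v)) HE (negPf l0) scale0r /tens3
  -[tens 0 _]/(tensr _ 0) !linear0.
Qed.

Lemma aided_le_exists p U V W (S : tensor3 U V W) :
  (0 < p)%N -> exists r, aided_le p S r.
Proof.
move=> p0.
have eU := vbasisP {:U}%VS; have eV := vbasisP {:V}%VS.
pose f i := S (@linfun K U K^o (coord (vbasis {:U}) i)).
pose g i j := f i (@linfun K V K^o (coord (vbasis {:V}) j)).
pose I := ('I_(\dim {:U}) * 'I_(\dim {:V}))%type.
pose F (i : 'I_(\dim {:U})) (j : 'I_(\dim {:V})) :=
  tens3 (vbasis {:U})`_i (vbasis {:V})`_j (g i j).
have -> : S = \sum_(s < #|{: I}|) F (enum_val s).1 (enum_val s).2.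
  rewrite {1}(tens_decomp S eU).
  rewrite -(@big_enum_val _ _ _ _ predT (fun ij : I => F ij.1 ij.2)) /=.
  rewrite -(pair_bigA _ F) /=; apply: eq_bigr => i _.
  by rewrite -/(f i) {1}(tens_decomp (f i) eV) linear_sum.
by exists #|{: I}|; apply: aided_le_sum.
Qed.

Lemma aided_rankP p U V W (S : tensor3 U V W) : (0 < p)%N ->
  aided_le p S (aided_rank p S) /\
  forall s, aided_le p S s -> (aided_rank p S <= s)%N.
Proof.
move=> /(aided_le_exists S) exS.
have exb : exists r, `[< aided_le p S r >] by have [r /asboolP] := exS; exists r.
suff [r rP] : exists r,
    aided_le p S r /\ forall s, aided_le p S s -> (r <= s)%N.
  exact: (@xgetPex _ 0%N [set r | aided_le p S r /\
    forall s, aided_le p S s -> (r <= s)%N]) (ex_intro _ r rP).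
case: (ex_minnP exb) => r /asboolP rS rmin; exists r; split=> // s sS.
exact/rmin/asboolP.
Qed.

End Tensors.

(* Main.v *)
From HB Require Import structures.
Require Import Defs.
From mathcomp Require Import all_boot all_order all_algebra.
From mathcomp Require Import complex.
From mathcomp Require Import reals.

Import GRing.Theory Num.Theory.
Local Open Scope ring_scope.

(** The aided rank is a rank with respect to matrices of rank at most [p]: the
    tensors to which [aided p (unit_tensor r)] restricts are exactly the sums of
    [r] terms [tens u N] with [mat_rank N <= p] ([aided_leP]). Indeed the aided
    unit tensor is a sum of [r] blocks [e_i (x) \sum_l e_il (x) e_il] whose
    matrix parts have rank [p] and live on disjoint sets of basis vectors, so
    restriction can turn them independently into arbitrary [tens u N].

    The reduced tensor is [S - w (x) M_1] with [w = e_1 + \sum_j lambda_j e_j]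
    ([slice_redE]), and both inequalities follow. If [M_1] has rank at most [p],
    then adding back the single term [w (x) M_1] gives
    [R(S) <= R(\hat S) + 1] for every [lambda]. Conversely take a shortest
    decomposition [S = \sum_i u_i (x) N_i], and let [c_i] be the first coordinate
    of [u_i], so that [M_1 = \sum_i c_i N_i]. As [M_1 != 0], some [c_k] is
    nonzero; choosing [lambda] so that [u_k = c_k w] yields
    [\hat S = \sum_i (u_i - c_i w) (x) N_i], in which the term of index [k]
    vanishes. *)

Section AidedDecomposition.
Set Implicit Arguments.
Unset Strict Implicit.
Variable K : fieldType.
Implicit Types U V W X : vectType K.

(** * Decompositions into matrices of bounded rank *)

Lemma lfun_std_vec X n (x : 'I_n -> X) :
  exists f : 'Hom('rV[K]_n, X), forall i, f (std_vec K i) = x i.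
Proof.
pose g (a : 'rV[K]_n) := \sum_i a 0 i *: x i.
have gl : linear g.
  move=> a b c; rewrite /g scaler_sumr -big_split; apply: eq_bigr => i _.
  by rewrite !mxE scalerDl scalerA.
pose G : {linear 'rV[K]_n -> X} :=
  HB.pack g (GRing.isLinear.Build K _ _ _ _ gl).
exists (linfun G) => i; rewrite (lfunE G) /= /g (bigD1 i) //= big1 => [|j ji].
  by rewrite mxE !eqxx scale1r addr0.
by rewrite mxE (negPf ji) andbF scale0r.
Qed.

Lemma lfun_eval U V (phi : dual U) :
  exists f : 'Hom(tensor U V, V), forall t, f t = t phi.
Proof.
pose g (t : tensor U V) := t phi.
have gl : linear g by move=> a s t; rewrite /g add_lfunE scale_lfunE.
pose G : {linear tensor U V -> V} :=
  HB.pack g (GRing.isLinear.Build K _ _ _ _ gl).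
by exists (linfun G) => t; rewrite (lfunE G).
Qed.

(** The products of standard basis vectors are linearly independent, so a linear
    map may be prescribed on them; it is assembled by contracting the first
    factor with each dual basis vector. *)
Lemma lfun_tens_std_vec X r p (x : 'I_r -> 'I_p -> X) :
  exists f : 'Hom(tensor 'rV[K]_r 'rV[K]_p, X),
    forall i l, f (tens (std_vec K i) (std_vec K l)) = x i l.
Proof.
have /fin_all_exists [g gE] i := lfun_std_vec (x i).
have /fin_all_exists [d dE] (i : 'I_r) :=
  lfun_std_vec (fun j : 'I_r => ((i == j)%:R : K^o)).
have /fin_all_exists [h hE] i := lfun_eval 'rV[K]_p (d i).
exists (\sum_i (g i \o h i)%VF) => i l; rewrite sum_lfunE (bigD1 i) //=.
rewrite big1 => [|j ji]; rewrite comp_lfunE hE tensE dE.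
  by rewrite eqxx scale1r gE addr0.
by rewrite (negPf ji) scale0r linear0.
Qed.

Lemma mat_rank_sum_tens V W p (v : 'I_p -> V) (w : 'I_p -> W) :
  (mat_rank (\sum_l tens (v l) (w l)) <= p)%N.
Proof.
have sub : (limg (\sum_l tens (v l) (w l))%R <= <<[tuple w l | l < p]>>)%VS.
  apply/subvP => _ /memv_imgP [phi _ ->]; rewrite sum_lfunE.
  apply: memv_suml => l _; rewrite tensE memvZ // memv_span //.
  exact: map_f (mem_enum _ _).
apply: leq_trans (dimvS sub) _; apply: leq_trans (dim_span _) _.
by rewrite size_tuple.
Qed.

Lemma sub_span_tuple V (U : {vspace V}) p :
  (\dim U <= p)%N -> exists X : p.-tuple V, (U <= <<X>>)%VS.
Proof.
(* The basis of U is padded with zeros by the default value of nth. *)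
move=> dU; exists [tuple (vbasis U)`_l | l < p].
rewrite -{1}(span_basis (vbasisP U)); apply/span_subvP => u ub.
have lt_p : (index u (vbasis U) < p)%N.
  apply: leq_trans dU.
  by rewrite -[X in (_ < X)%N](size_tuple (vbasis U)) index_mem.
by rewrite memv_span // -(nth_index 0 ub); apply/mapP; exists (Ordinal lt_p);
  rewrite ?mem_enum.
Qed.

(** Rank factorization: expand [N] along a basis of [V], then expand its values
    along [p] vectors spanning the image of [N], and exchange the two sums. *)
Lemma mat_rank_decomp V W p (N : tensor V W) : (mat_rank N <= p)%N ->
  exists (v : 'I_p -> V) (w : 'I_p -> W), N = \sum_l tens (v l) (w l).
Proof.
move=> /sub_span_tuple [X limgX]; set b := vbasis {:V}.
pose f (i : 'I_(\dim {:V})) := N (@linfun K V K^o (coord b i)).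
exists (fun l => \sum_i coord X l (f i) *: b`_i), (fun l => X`_l).
rewrite {1}(tens_decomp N (vbasisP {:V})).
under [RHS]eq_bigr do rewrite -[tens _ _]/(tensr _ _) linear_sum.
rewrite exchange_big; apply: eq_bigr => i _ /=.
have fX : f i \in <<X>>%VS by apply: (subvP limgX); rewrite memv_img ?memvf.
rewrite -/(f i) {1}(coord_span fX) linear_sum; apply: eq_bigr => l _ /=.
by rewrite !linearZ.
Qed.

Lemma tens_map3_aided_unit p r U V W (A : 'Hom('rV[K]_r, U))
    (B : 'Hom(tensor 'rV[K]_r 'rV[K]_p, V))
    (C : 'Hom(tensor 'rV[K]_r 'rV[K]_p, W)) :
  tens_map3 A B C (aided p (unit_tensor K r)) =
  \sum_(i < r) tens (A (std_vec K i))
    (\sum_(l < p) tens (B (tens (std_vec K i) (std_vec K l)))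
                       (C (tens (std_vec K i) (std_vec K l)))).
Proof.
rewrite aided_unit /tens_map3 linear_sum; apply: eq_bigr => i _.
rewrite !linear_sum; apply: eq_bigr => l _.
exact: tens_map3_tens3.
Qed.

(** The image of the [i]-th block of the aided unit tensor is an arbitrary vector
    tensored with an arbitrary sum of [p] pure tensors, i.e. an arbitrary matrix
    of rank at most [p]. *)
Lemma aided_leP p U V W (S : tensor3 U V W) r :
  aided_le p S r <->
  exists (u : 'I_r -> U) (N : 'I_r -> tensor V W),
    (forall i, mat_rank (N i) <= p)%N /\ S = \sum_i tens (u i) (N i).
Proof.
split=> [[A [B [C ->]]]|[u [N [rkN ->]]]].
  rewrite tens_map3_aided_unit; do 2!eexists; split; last by [].
  by move=> i; apply: mat_rank_sum_tens.
have [A AE] := lfun_std_vec u.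
have /fin_all_exists [v /fin_all_exists [w NE]] i := mat_rank_decomp (rkN i).
have [B BE] := lfun_tens_std_vec v; have [C CE] := lfun_tens_std_vec w.
exists A, B, C; rewrite tens_map3_aided_unit; apply: eq_bigr => i _.
by rewrite AE NE; congr tens; apply: eq_bigr => l _; rewrite BE CE.
Qed.

Lemma aided_le_add_tens p U V W (S : tensor3 U V W) r (u : U)
    (N : tensor V W) :
  (mat_rank N <= p)%N -> aided_le p S r -> aided_le p (S + tens u N) r.+1.
Proof.
move=> rkN /aided_leP [x [L [rkL ->]]]; apply/aided_leP.
exists (fun i => oapp x u (unlift ord0 i)), (fun i => oapp L N (unlift ord0 i)).
split=> [i|]; first by case: (unlift _ i) => [j|] /=.
rewrite big_ord_recl unlift_none /= addrC; congr (_ + _).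
by apply: eq_bigr => i _; rewrite liftK.
Qed.

(** * Removing a slice *)

Section SliceReduction.
Variables (V1 V2 V3 : vectType K) (n : nat) (e : n.+1.-tuple V1).
Variable M : 'I_n.+1 -> tensor V2 V3.
Hypothesis e_basis : basis_of fullv e.

Let S : tensor3 V1 V2 V3 := \sum_(i < n.+1) tens e`_i (M i).

Lemma slice_redE (lambda : 'I_n -> K) :
  slice_red e M lambda =
  S - tens (e`_0 + \sum_(j < n) lambda j *: e`_(lift ord0 j)) (M ord0).
Proof.
rewrite /S big_ord_recl /slice_red -[tens (_ + _) _]/(tensr _ _) linearD /=.
rewrite opprD addrACA subrr add0r linear_sum -sumrB; apply: eq_bigr => j _.
by rewrite linearB !linearZ.
Qed.

Lemma aided_le_slice_red_succ p r (lambda : 'I_n -> K) :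
  (mat_rank (M ord0) <= p)%N ->
  aided_le p (slice_red e M lambda) r -> aided_le p S r.+1.
Proof.
move=> rkM /(aided_le_add_tens
  (e`_0 + \sum_(j < n) lambda j *: e`_(lift ord0 j)) rkM).
by rewrite slice_redE subrK.
Qed.

Lemma first_slice r (u : 'I_r -> V1) (N : 'I_r -> tensor V2 V3) :
  S = \sum_k tens (u k) (N k) -> M ord0 = \sum_k coord e ord0 (u k) *: N k.
Proof.
move/(congr1 (fun t : tensor3 V1 V2 V3 =>
  t (@linfun K V1 K^o (coord e ord0)))).
rewrite !sum_lfunE (bigD1 ord0) //= big1 => [|i i0]; last first.
  rewrite tensE lfunE /= coord_free ?(basis_free e_basis) // (negPf i0).
  by rewrite scale0r.
rewrite tensE lfunE /= (coord_free ord0 ord0) ?(basis_free e_basis) //.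
rewrite scale1r addr0 => ->.
by apply: eq_bigr => k _; rewrite tensE lfunE.
Qed.

(** The vector [u k] used up by a term contributing to the first slice dictates
    [lambda]: subtracting multiples of [u k] from all vectors of the
    decomposition annihilates both the first slice and the [k]-th term. *)
Lemma aided_le_slice_red p r : M ord0 != 0 -> aided_le p S r ->
  (0 < r)%N /\ exists lambda : 'I_n -> K, aided_le p (slice_red e M lambda) r.-1.
Proof.
move=> M0 /aided_leP [u [N [rkN SE]]]; have ME := first_slice SE.
pose c k := coord e ord0 (u k).
have [k ck0] : exists k, c k != 0.
  apply/existsP; apply: contraNT M0; rewrite negb_exists ME => /forallP c0.
  by apply/eqP; apply: big1 => k _; have /negPn /eqP := c0 k; rewrite /c => ->;
    rewrite scale0r.
case: r => [|r] in u N rkN SE ME c k ck0 *; first by case: k ck0.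
pose lambda j := coord e (lift ord0 j) (u k) / c k.
pose w := e`_0 + \sum_(j < n) lambda j *: e`_(lift ord0 j).
have uk : u k = c k *: w.
  rewrite {1}(coord_basis e_basis (memvf (u k))) big_ord_recl scalerDr.
  congr (_ + _); rewrite scaler_sumr; apply: eq_bigr => j _.
  by rewrite scalerA mulrC divfK.
split=> //; exists lambda; apply/aided_leP.
exists (fun i => u (lift k i) - c (lift k i) *: w), (fun i => N (lift k i)).
split=> [i|]; first exact: rkN.
rewrite slice_redE -/w ME SE linear_sum -sumrB (bigD1_ord k) //=.
(* The k-th term is exactly what the first slice subtracts for it. *)
have -> : tens (u k) (N k) = tens w (coord e ord0 (u k) *: N k).
  by rewrite linearZ {1}uk -[tens (_ *: _) _]/(tensr _ _) linearZ.
rewrite subrr add0r; apply: eq_bigr => i _.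
by rewrite -[tens (_ - _) _]/(tensr _ _) linearB !linearZ.
Qed.

End SliceReduction.
End AidedDecomposition.

Theorem theorem4p11 (R : realType) (V1 V2 V3 : vectType R[i]) (n p : nat)
    (e : n.+1.-tuple V1) (M : 'I_n.+1 -> tensor V2 V3) (S : tensor3 V1 V2 V3) :
  (1 <= p)%N ->
  basis_of fullv e ->
  S = \sum_(i < n.+1) tens e`_i (M i) ->
  M ord0 != 0 ->
  [/\ exists lambda : 'I_n -> R[i],
        (aided_rank p (slice_red e M lambda))%:Z <= (aided_rank p S)%:Z - 1,
      (mat_rank (M ord0) <= p)%N ->
        forall lambda : 'I_n -> R[i],
          (aided_rank p (slice_red e M lambda))%:Z >= (aided_rank p S)%:Z - 1
    & (mat_rank (M ord0) <= p)%N ->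
        exists lambda : 'I_n -> R[i],
          (aided_rank p (slice_red e M lambda))%:Z = (aided_rank p S)%:Z - 1].
Proof.
move=> p_gt0 e_basis SE M0.
have rankP (T : tensor3 V1 V2 V3) := aided_rankP T p_gt0.
have [lambda upper] : exists lambda : 'I_n -> R[i],
    (aided_rank p (slice_red e M lambda))%:Z <= (aided_rank p S)%:Z - 1.
  have [leS _] := rankP S; rewrite {1}SE in leS.
  have [r_gt0 [lambda leS']] := aided_le_slice_red e_basis M0 leS.
  exists lambda; rewrite -subn1 in leS'.
  by rewrite subzn // lez_nat; apply: (rankP _).2.
have lower : (mat_rank (M ord0) <= p)%N -> forall lambda : 'I_n -> R[i],
    (aided_rank p S)%:Z - 1 <= (aided_rank p (slice_red e M lambda))%:Z.
  move=> rkM mu; rewrite lerBlDr -PoszD lez_nat addn1; apply: (rankP _).2.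
  by rewrite SE; apply: aided_le_slice_red_succ rkM (rankP _).1.
split=> [|//|rkM]; first by exists lambda.
by exists lambda; apply/eqP; rewrite Order.POrderTheory.eq_le upper lower.
Qed.
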